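(* Let $P=[p_{ij}]$ be the $m\times m$ transition matrix of a finite irreducible discrete time Markov chain with stationary probabilities $\pi_1,\dots,\pi_m$, column sums $c_j=\sum_{i=1}^m p_{ij}$ with $c^T=(c_1,\dots,c_m)$, and mean first passage times $m_{ij}$. Let $H=[h_{ij}]=[I-P+ec^T]^{-1}$, where $e$ is the column vector of ones. Then for all $j\in\{1,\dots,m\}$, $$\sum_{i=1}^m m_{ij}-\sum_{i=1}^m c_im_{ij}=m-\frac{c_j}{\pi_j}=m-c_jm_{jj},$$ $$\sum_{i=1}^m c_im_{ij}=\frac{c_j}{\pi_j}-1+\frac{mh_{jj}}{\pi_j}=c_jm_{jj}-1+mh_{jj}m_{jj},$$ and hence $$\sum_{i=1}^m m_{ij}=m_{\bullet j}=m-1+\frac{mh_{jj}}{\pi_j}=m-1+mh_{jj}m_{jj}.$$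
   Context: The chain $\{X_n\}_{n\ge0}$ has state space $\{1,\dots,m\}$. $P$ is row-stochastic: $p_{ij}\ge 0$ and $\sum_{j=1}^m p_{ij}=1$ for all $i$. The stationary probability vector is the unique $\pi$ with $\pi^TP=\pi^T$ and $\pi^Te=1$. The mean first passage time is $m_{ij}=E[\min\{n\ge1: X_n=j\}\mid X_0=i]$, which is finite for all $i,j$ (so $m_{jj}$ is the mean return time to $j$). Here $m$ without subscripts is the number of states, and $m_{\bullet j}:=\sum_{i=1}^m m_{ij}$. The matrix $I-P+ec^T$ is nonsingular, so $H$ is well defined. *)

(* Defs.v *)
From HB Require Import structures.
From mathcomp Require Import all_boot all_order all_algebra.
From mathcomp Require Import all_classical all_reals all_analysis.

Set Implicit Arguments.
Unset Strict Implicit.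
Unset Printing Implicit Defensive.

Import Order.TTheory GRing.Theory Num.Theory.

Local Open Scope classical_set_scope.
Local Open Scope ring_scope.

Definition row_stochastic (R : realType) (m : nat) (P : 'M[R]_m) : Prop :=
  (forall i j, 0 <= P i j) /\ (forall i, \sum_j P i j = 1).

Definition irreducible (R : realType) (m : nat) (P : 'M[R]_m) : Prop :=
  forall i j, exists n : nat, 0 < (P ^+ n) i j.

Definition ones (R : realType) (m : nat) : 'cV[R]_m := const_mx 1.

(* No sign condition: for irreducible [P] these two equations already have a
   unique solution, which is positive. *)
Definition stationary (R : realType) (m : nat) (P : 'M[R]_m) (p : 'cV[R]_m)
    : Prop :=
  p^T *m P = p^T /\ p^T *m ones R m = 1%:M.

Definition colsum (R : realType) (m : nat) (P : 'M[R]_m) : 'cV[R]_m :=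
  \col_j \sum_i P i j.

Definition Hmx (R : realType) (m : nat) (P : 'M[R]_m) : 'M[R]_m :=
  invmx (1%:M - P + ones R m *m (colsum P)^T).

Definition trajectory (T : Type) (m : nat) (X : nat -> T -> 'I_m)
    (s : nat -> 'I_m) (n : nat) : set T :=
  [set w | forall k, (k <= n)%N -> X k w = s k].

(* The Markov property in product form, so that conditioning events of
   probability zero impose nothing; the initial law is arbitrary. *)
Definition markov_chain (R : realType) (d : measure_display)
    (T : measurableType d) (Pr : probability T R) (m : nat)
    (X : nat -> T -> 'I_m) (P : 'M[R]_m) : Prop :=
  (forall n i, measurable (X n @^-1` [set i])) /\
  (forall (n : nat) (s : nat -> 'I_m),
     (Pr (trajectory X s n.+1) =
      Pr (trajectory X s n) * (P (s n) (s n.+1))%:E)%E).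

(* [min {n >= 1 : X_n = j}], with value [+oo] when [j] is never visited. *)
Definition first_passage_time (R : realType) (T : Type) (m : nat)
    (X : nat -> T -> 'I_m) (j : 'I_m) (w : T) : \bar R :=
  ereal_inf [set (n%:R)%:E | n in [set n : nat | (0 < n)%N /\ X n w = j]].

(* Elementary conditional expectation, meaningful when [Pr A > 0]. *)
Definition cond_expectation (R : realType) (d : measure_display)
    (T : measurableType d) (Pr : probability T R) (Y : T -> \bar R)
    (A : set T) : \bar R :=
  ((\int[Pr]_(w in A) Y w) * ((fine (Pr A))^-1)%:E)%E.

(* [Pr i] is a law of the chain that charges the event [X_0 = i].  A constant
   family is a single chain whose initial law has full support; [Pr i] with
   [X_0 = i] almost surely gives the usual family of laws started at [i]. *)
Definition mean_first_passage_time (R : realType) (d : measure_display)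
    (T : measurableType d) (m : nat) (Pr : 'I_m -> probability T R)
    (X : nat -> T -> 'I_m) (i j : 'I_m) : \bar R :=
  cond_expectation (Pr i) (first_passage_time R X j) (X 0%N @^-1` [set i]).

(* Main.v *)
(* Let [Q] be [P] with column [j] set to zero.  The probability of avoiding [j]
   at times [1, ..., n] from [i] is [(Q^n e)_i], so the mean first passage times
   to [j] form the vector [x = \sum_n Q^n e = (I - Q)^-1 e], which satisfies
   [x = e + P x - x_j P e_j].  Multiplying this equation on the left by [p^T]
   gives [x_j p_j = 1], by [e^T] the first identity, and by [H] the second one,
   using [H e = e / m] and [H P = H - I + e c^T / m]. *)

Require Import Defs.
From mathcomp Require Import all_boot all_order all_algebra.
From mathcomp Require Import all_classical all_reals all_analysis.
From mathcomp Require Import measurable_realfun ring lra.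

Set Implicit Arguments.
Unset Strict Implicit.
Unset Printing Implicit Defensive.

Import Order.TTheory GRing.Theory Num.Theory.
Import numFieldNormedType.Exports.
Local Open Scope classical_set_scope.
Local Open Scope ring_scope.

(** * Stochastic matrices and irreducibility *)

Lemma unitmx_of_trivial_kernel (F : fieldType) (n : nat) (A : 'M[F]_n) :
  (forall v : 'cV_n, A *m v = 0 -> v = 0) -> A \in unitmx.
Proof.
move=> kerA; rewrite -unitmx_tr -row_free_unit; apply: inj_row_free => v vA0.
by apply: trmx_inj; rewrite trmx0; apply: kerA; rewrite -[A]trmxK -trmx_mul vA0 trmx0.
Qed.

Lemma ones_eq1 (R : realType) (m : nat) (i : 'I_m) : ones R m i 0 = 1.
Proof. by rewrite mxE. Qed.

Lemma stochastic_ones (R : realType) (m : nat) (P : 'M[R]_m) :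
  row_stochastic P -> P *m ones R m = ones R m.
Proof.
move=> [_ P1]; apply/matrixP => i l; rewrite !mxE -[RHS](P1 i).
by apply: eq_bigr => k _; rewrite mxE mulr1.
Qed.

Lemma stochastic_exp_ge0 (R : realType) (m : nat) (P : 'M[R]_m) (n : nat) i j :
  row_stochastic P -> 0 <= (P ^+ n) i j.
Proof.
move=> [P0 _]; elim: n i => [|n IH] i; first by rewrite expr0 mxE ler0n.
by rewrite exprS mxE; apply: sumr_ge0 => k _; apply: mulr_ge0.
Qed.

(** Induction on the [n] with [(P ^+ n) i j > 0]: a positive entry of $P P^n$ has a positive term,
    whose first factor is a transition from [i] to some [k], again in [S]. *)
Lemma irreducible_closed_full (R : realType) (m : nat) (P : 'M[R]_m)
    (S : {pred 'I_m}) (i j : 'I_m) :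
  row_stochastic P -> irreducible P ->
  (forall k l, k \in S -> 0 < P k l -> l \in S) -> i \in S -> j \in S.
Proof.
move=> hP hirr clS; have [n] := hirr i j.
elim: n i => [|n IH] i.
  by rewrite expr0 mxE; have [->//|_] := eqVneq i j; rewrite ltxx.
rewrite exprS mxE => Pij iS.
have P0 : forall k, true -> 0 <= P i k * (P ^+ n) k j.
  by move=> k _; apply: mulr_ge0; [case: hP|apply: stochastic_exp_ge0].
have [k /= kgt0] := psumr_neq0P P0 (elimN eqP (lt0r_neq0 Pij)).
have Pik : 0 < P i k.
  rewrite lt0r; case: hP => -> _; rewrite andbT.
  by apply: contraTN kgt0 => /eqP ->; rewrite mul0r ltxx.
apply: (IH k); last exact: clS iS Pik.
by rewrite -(pmulr_rgt0 _ Pik).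
Qed.

(** * Taboo matrix and invertibility of $I - Q$ *)

(** Row [j] is kept, so that starting in [j] is covered too and yields the return time. *)
Definition taboo (R : realType) (m : nat) (P : 'M[R]_m) (j : 'I_m) : 'M[R]_m :=
  \matrix_(i, k) if k == j then 0 else P i k.

Lemma taboo_ge0 (R : realType) (m : nat) (P : 'M[R]_m) (j i k : 'I_m) :
  row_stochastic P -> 0 <= taboo P j i k.
Proof. by move=> [P0 _]; rewrite mxE; case: ifP. Qed.

Lemma taboo_le (R : realType) (m : nat) (P : 'M[R]_m) (j i k : 'I_m) :
  row_stochastic P -> taboo P j i k <= P i k.
Proof. by move=> [P0 _]; rewrite mxE; case: ifP. Qed.

Lemma taboo_mulE (R : realType) (m : nat) (P : 'M[R]_m) (j : 'I_m) (v : 'cV_m) :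
  taboo P j *m v = P *m v - v j 0 *: col j P.
Proof.
apply/matrixP => i l; rewrite ord1 !mxE (bigD1 j)//= [X in _ = X - _](bigD1 j)//=.
rewrite mxE eqxx mul0r add0r mulrC addrAC subrr add0r.
by apply: eq_bigr => k /negbTE kj; rewrite mxE kj.
Qed.

(* Maximum principle: the set where [|v|] is maximal is closed under [P] and
   has no transition into [j], which irreducibility forbids. *)
Lemma taboo_fixed_eq0 (R : realType) (m : nat) (P : 'M[R]_m) (j : 'I_m)
    (v : 'cV_m) :
  row_stochastic P -> irreducible P -> taboo P j *m v = v -> v = 0.
Proof.
move=> hP hirr Qv; case: (hP) => P0 P1.
pose i0 := [arg max_(i > j) `|v i 0|]%O.
pose a := `|v i0 0|.
have va i : `|v i 0| <= a.
  by rewrite /a /i0; case: Order.TotalTheory.arg_maxP => // k _; apply.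
have [a0|a_gt0] := leP a 0.
  apply/matrixP => i l; rewrite ord1 mxE; apply/eqP.
  by rewrite -normr_le0 (le_trans (va i)).
(* Equality case of $a = |v_i| \le \sum_k Q_{ik} |v_k| \le \sum_k P_{ik} a = a$: the nonnegative
   differences have sum zero, so each one vanishes. *)
have tight i k : `|v i 0| = a -> P i k * a = taboo P j i k * `|v k 0|.
  move=> via; apply/eqP; rewrite -subr_eq0; apply/eqP.
  apply: (psumr_eq0P (P := xpredT) (F := fun k => P i k * a - taboo P j i k * `|v k 0|)) => //.
    move=> l _; rewrite subr_ge0; apply: ler_pM => //; first exact: taboo_ge0.
    exact: taboo_le.
  apply/eqP; rewrite eq_le sumr_ge0 ?andbT; last first.
    move=> l _; rewrite subr_ge0; apply: ler_pM => //; first exact: taboo_ge0.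
    exact: taboo_le.
  rewrite sumrB -mulr_suml P1 mul1r subr_le0 -{1}via -{1}Qv mxE.
  apply: le_trans (ler_norm_sum _ _ _) _; apply: ler_sum => l _.
  by rewrite normrM ger0_norm// taboo_ge0.
pose S : {pred 'I_m} := [pred i | `|v i 0| == a].
(* For [k = j] the right side of [tight] is zero, while the left side is positive. *)
have Pj i k : i \in S -> 0 < P i k -> k != j.
  move=> /eqP /(tight i k) e Pik; apply/eqP => kj; move: e.
  rewrite mxE kj eqxx mul0r => /eqP; rewrite -kj mulf_eq0.
  by rewrite (gt_eqF Pik) (gt_eqF a_gt0).
have Sfull k : k \in S.
  apply: (@irreducible_closed_full _ _ P S i0) => //; last by rewrite inE.
  move=> i l iS Pil; have lj := Pj _ _ iS Pil.
  move/eqP : iS => /(tight i l); rewrite mxE (negbTE lj) => /(mulfI (lt0r_neq0 Pil)) al.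
  by rewrite inE -al.
have Pne i k : 0 < P i k -> k \in predC1 j by exact: Pj.
(* Row [j] sums to 1, so some [k] follows [j]. By [Pne] the complement of [j] is closed and contains
   [k], so irreducibility would put [j] into it. *)
have [k /= Pjk] : exists k, true && (0 < P j k).
  by apply: psumr_neq0P => //; rewrite P1; exact/eqP/oner_neq0.
have : j \in predC1 j.
  by apply: (@irreducible_closed_full _ _ P (predC1 j) k j hP hirr _ (Pne _ _ Pjk)) => ? l _; exact: Pne.
by rewrite inE eqxx.
Qed.

Lemma taboo_unitmx (R : realType) (m : nat) (P : 'M[R]_m) (j : 'I_m) :
  row_stochastic P -> irreducible P -> 1%:M - taboo P j \in unitmx.
Proof.
move=> hP hirr; apply: unitmx_of_trivial_kernel => v.
rewrite mulmxBl mul1mx => /eqP; rewrite subr_eq0 => /eqP /esym.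
exact: taboo_fixed_eq0.
Qed.

(** * Survival probabilities and their sum *)

(* [survival P j n i] is the probability of not meeting [j] at times
   [1, ..., n] when started at [i]. *)
Definition survival (R : realType) (m : nat) (P : 'M[R]_m) (j : 'I_m) (n : nat)
    : 'cV[R]_m := iter n (mulmx (taboo P j)) (ones R m).

Lemma survival_ge0_le1 (R : realType) (m : nat) (P : 'M[R]_m) (j : 'I_m) n i :
  row_stochastic P -> 0 <= survival P j n i 0 <= 1.
Proof.
move=> hP; elim: n i => [|n IH] i; first by rewrite /= ones_eq1 ler01 lexx.
rewrite /= mxE; apply/andP; split.
  by apply: sumr_ge0 => k _; apply: mulr_ge0; [exact: taboo_ge0|case/andP: (IH k)].
case: (hP) => _ /(_ i) <-; apply: ler_sum => k _; rewrite -[leRHS]mulr1.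
have /andP[? ?] := IH k; apply: ler_pM => //; first exact: taboo_ge0.
exact: taboo_le.
Qed.

(** The algebra is carried out on this real vector; [mean_first_passage_timeE] later identifies it
    with the expectations. The value of [invmx] is a true inverse by [taboo_unitmx]. *)
Definition mean_passage (R : realType) (m : nat) (P : 'M[R]_m) (j : 'I_m)
    : 'cV[R]_m := invmx (1%:M - taboo P j) *m ones R m.

(** Telescoping: $(I - Q) \sum_{k<n} Q^k e = e - Q^n e$. *)
Lemma sum_survival (R : realType) (m : nat) (P : 'M[R]_m) (j : 'I_m) n :
  row_stochastic P -> irreducible P ->
  \sum_(k < n) survival P j k =
    mean_passage P j - invmx (1%:M - taboo P j) *m survival P j n.
Proof.
move=> hP hirr; have U := taboo_unitmx j hP hirr.
rewrite -mulmxBr; apply: (canRL (mulKmx U)).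
elim: n => [|n IH]; first by rewrite big_ord0 mulmx0 subrr.
by rewrite big_ord_recr/= mulmxDr IH mulmxBl mul1mx addrA subrK.
Qed.

(* The resolvent identity bounds the partial sums, since [survival] stays in
   [0, 1]; convergence then forces [survival] to vanish in the limit. *)
Lemma cvg_sum_survival (R : realType) (m : nat) (P : 'M[R]_m) (j i : 'I_m) :
  row_stochastic P -> irreducible P ->
  series (fun n => survival P j n i 0) @ \oo --> mean_passage P j i 0.
Proof.
move=> hP hirr; pose Z := invmx (1%:M - taboo P j).
have E k n : series (fun n => survival P j n k 0) n
    = mean_passage P j k 0 - \sum_l Z k l * survival P j n l 0.
  rewrite /series/= big_mkord -summxE sum_survival// [LHS]mxE; congr (_ + _).
  by rewrite [LHS]mxE; congr (- _); rewrite mxE.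
have C k : cvgn (series (fun n => survival P j n k 0)).
  apply: nondecreasing_is_cvgn.
    by apply: nondecreasing_series => n _ _; case/andP: (survival_ge0_le1 j n k hP).
  exists (mean_passage P j k 0 + \sum_l `|Z k l|) => _ [n _ <-].
  rewrite E lerD2l -sumrN; apply: ler_sum => l _.
  have /andP[u0 u1] := survival_ge0_le1 j n l hP.
  apply: le_trans (ler_norm _) _; rewrite normrN normrM -[leRHS]mulr1.
  by apply: ler_pM => //; rewrite ger0_norm.
have u0 k : survival P j n k 0 @[n --> \oo] --> (0 : R) by exact: cvg_series_cvg_0.
rewrite (_ : series _ = fun n => mean_passage P j i 0 - \sum_l Z i l * survival P j n l 0).
  rewrite -[X in _ --> X]subr0; apply: cvgB; first exact: cvg_cst.
  rewrite [X in _ --> X](_ : 0 = \sum_(l < m) Z i l * 0); last by rewrite big1// => l _; rewrite mulr0.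
  apply: cvg_big => [|l _]; first exact: add_continuous.
  apply: cvgM; [exact: cvg_cst|exact: u0].
by apply/funext => n; rewrite E.
Qed.

(** * First-step equation and the matrix identities drawn from it *)

(** This is $(I - Q) x = e$ with $Q x$ expanded by [taboo_mulE]. *)
Lemma mean_passageE (R : realType) (m : nat) (P : 'M[R]_m) (j : 'I_m) :
  row_stochastic P -> irreducible P ->
  mean_passage P j =
    ones R m + (P *m mean_passage P j - mean_passage P j j 0 *: col j P).
Proof.
move=> hP hirr; rewrite -taboo_mulE; apply/eqP; rewrite -subr_eq; apply/eqP.
rewrite -{1}[mean_passage P j]mul1mx -mulmxBl /mean_passage mulKVmx//.
exact: taboo_unitmx.
Qed.

(** Under $p^T$ the terms $x$ and $P x$ of the first-step equation cancel. The result also shows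
    $p_j \ne 0$, on which the final divisions rest. *)
Lemma mean_return (R : realType) (m : nat) (P : 'M[R]_m) (p : 'cV[R]_m) j :
  row_stochastic P -> irreducible P -> stationary P p ->
  mean_passage P j j 0 * p j 0 = 1.
Proof.
move=> hP hirr [pP p1]; have := mean_passageE j hP hirr.
move: (mean_passage P j) => x /(congr1 (fun y => (p^T *m y) 0 0)).
rewrite mulmxDr p1 mulmxBr mulmxA pP -scalemxAr colE mulmxA pP -colE.
rewrite !mxE eqxx mulr1n => e; lra.
Qed.

Lemma ones_colsum (R : realType) (m : nat) (P : 'M[R]_m) :
  (ones R m)^T *m P = (colsum P)^T.
Proof.
by apply/matrixP => i k; rewrite !mxE; apply: eq_bigr => l _; rewrite !mxE mul1r.
Qed.

Lemma dot_ones (R : realType) (m : nat) (x : 'cV[R]_m) :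
  (ones R m)^T *m x = (\sum_i x i 0)%:M.
Proof.
apply/matrixP => a b; rewrite !ord1 !mxE eqxx mulr1n.
by apply: eq_bigr => k _; rewrite !mxE mul1r.
Qed.

Lemma dot_colsum (R : realType) (m : nat) (P : 'M[R]_m) (x : 'cV[R]_m) :
  (colsum P)^T *m x = (\sum_i colsum P i 0 * x i 0)%:M.
Proof.
apply/matrixP => a b; rewrite !ord1 mxE [RHS]mxE eqxx mulr1n.
by apply: eq_bigr => k _; rewrite [_^T _ _]mxE.
Qed.

Lemma colsum_mean_passage (R : realType) (m : nat) (P : 'M[R]_m) j :
  row_stochastic P -> irreducible P ->
  \sum_i mean_passage P j i 0 - \sum_i colsum P i 0 * mean_passage P j i 0
    = m%:R - colsum P j 0 * mean_passage P j j 0.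
Proof.
move=> hP hirr; have := mean_passageE j hP hirr.
move: (mean_passage P j) => x /(congr1 (fun y => ((ones R m)^T *m y) 0 0)).
rewrite mulmxDr mulmxBr -scalemxAr colE !mulmxA ones_colsum -colE dot_colsum !dot_ones.
set s := \sum_i x i 0.
set t := (\sum_i colsum P i 0 * _).
rewrite (_ : \sum_i ones R m i 0 = m%:R); last first.
  by under eq_bigr do rewrite ones_eq1; rewrite sumr_const card_ord.
by rewrite !mxE /= !mulr1n => e; lra.
Qed.

Lemma colsum_ones (R : realType) (m : nat) (P : 'M[R]_m) :
  row_stochastic P -> (colsum P)^T *m ones R m = m%:R%:M.
Proof.
move=> hP; rewrite -ones_colsum -mulmxA stochastic_ones// dot_ones; congr _%:M.
by under eq_bigr do rewrite ones_eq1; rewrite sumr_const card_ord.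
Qed.

(** For $v$ in the kernel, $p^T$ kills $I - P$ and leaves $c^T v = 0$. Hence $P v = v$, so $v$ is
    constant, and $c^T e = m \ne 0$ makes the constant zero. *)
Lemma Hmx_unit (R : realType) (m : nat) (P : 'M[R]_m) (p : 'cV[R]_m) :
  row_stochastic P -> irreducible P -> stationary P p ->
  1%:M - P + ones R m *m (colsum P)^T \in unitmx.
Proof.
move=> hP hirr [pP p1]; apply: unitmx_of_trivial_kernel => v Bv.
have cv : (colsum P)^T *m v = 0.
  have := congr1 (mulmx p^T) Bv.
  by rewrite !mulmxA mulmxDr mulmxBr mulmx1 pP subrr add0r mulmxA p1 mul1mx mulmx0.
move: Bv; rewrite mulmxDl -mulmxA cv mulmx0 addr0 mulmxBl mul1mx.
move/eqP; rewrite subr_eq0 => /eqP vP.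
apply/matrixP => j l; rewrite ord1 [RHS]mxE.
(* The vector $v - v_j e$ vanishes at [j], where alone $P$ and $Q$ act differently, so it is fixed
   by $Q$ as well and must be zero. *)
have v_cst : v = v j 0 *: ones R m.
  apply/eqP; rewrite -subr_eq0; apply/eqP.
  apply: (@taboo_fixed_eq0 _ _ P j) => //.
  rewrite taboo_mulE mulmxBr -vP -scalemxAr stochastic_ones//.
  by rewrite !mxE mulr1 subrr scale0r subr0.
move: cv; rewrite v_cst -scalemxAr colsum_ones// => /matrixP /(_ 0 0).
rewrite !mxE eqxx mulr1n mulr1 => /eqP; rewrite mulf_eq0 pnatr_eq0 => /orP[/eqP//|].
(* The case $m = 0$ is excluded because [j] inhabits ['I_m]. *)
by rewrite -leqn0 leqNgt (leq_ltn_trans _ (ltn_ord j)).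
Qed.

Lemma colsum_mean_passage_Hmx (R : realType) (m : nat) (P : 'M[R]_m)
    (p : 'cV[R]_m) (j : 'I_m) :
  row_stochastic P -> irreducible P -> stationary P p ->
  \sum_i colsum P i 0 * mean_passage P j i 0
    = colsum P j 0 * mean_passage P j j 0 - 1
      + m%:R * Hmx P j j * mean_passage P j j 0.
Proof.
move=> hP hirr hp; have U := Hmx_unit hP hirr hp.
have := mean_passageE j hP hirr; move: (mean_passage P j) => x xE.
set t := \sum_i _; set H := Hmx P.
have m_neq0 : m%:R != 0 :> R.
  by rewrite pnatr_eq0 -lt0n (leq_ltn_trans _ (ltn_ord j)).
(* The matrix inverted by [H] maps $e$ to $m e$, since $(I - P) e = 0$ and $c^T e = m$. *)
have He : H *m ones R m = m%:R^-1 *: ones R m.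
  apply: (canLR (mulKmx U)); rewrite -scalemxAr mulmxDl mulmxBl mul1mx.
  rewrite stochastic_ones// subrr add0r -mulmxA colsum_ones// mul_mx_scalar.
  by rewrite scalerA mulVf// scale1r.
have HP : H *m P = H - 1%:M + m%:R^-1 *: (ones R m *m (colsum P)^T).
  have : H *m (1%:M - P + ones R m *m (colsum P)^T) = 1%:M by exact: mulVmx.
  rewrite mulmxDr mulmxBr mulmx1 mulmxA He -scalemxAl.
  move: (H *m P) (_ *: _) => A B /matrixP e; apply/matrixP => a b.
  by have := e a b; rewrite !mxE => ?; lra.
(* Entry [j] of [H] times the first-step equation; $(H x)_j$ occurs on both sides and cancels. *)
move: xE => /(congr1 (fun y => (H *m y) j 0)).
rewrite mulmxDr mulmxBr -scalemxAr He mulmxA HP mulmxDl mulmxBl mul1mx.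
rewrite -scalemxAl -mulmxA dot_colsum -/t colE mulmxA HP.
move: (H *m x) => Hx; rewrite -[delta_mx j 0]/(delta_mx j 0) -colE.
have cE : \sum_i P i j = colsum P j 0 by rewrite mxE.
rewrite mul_mx_scalar !mxE !eqxx !mulr1n big_ord1 !mxE cE => e.
(* The same equation multiplied by $m$ to clear the inverses. *)
have {e} : 1 + t - (m%:R * (H j j - 1) + colsum P j 0) * x j 0 - m%:R * x j 0 = 0.
  move: e; move: (Hx j 0) (H j j) (x j 0) (colsum P j 0) => a b c f e.
  apply: (mulfI (invr_neq0 m_neq0)); rewrite mulr0.
  have mV : m%:R^-1 * m%:R = 1 :> R by rewrite mulVf.
  have -> : m%:R^-1 * (1 + t - (m%:R * (b - 1) + f) * c - m%:R * c) =
    m%:R^-1 * (1 + t) - m%:R^-1 * m%:R * (b * c) - m%:R^-1 * f * c by ring.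
  by rewrite mV; lra.
lra.
Qed.

(** * Avoidance events under the Markov property *)

(** A window of [r] times after time [n]: the induction moves its start forward by one while its
    length drops by one. For [r = 0] it is the whole space. *)
Definition avoids (T : Type) (m : nat) (X : nat -> T -> 'I_m) (j : 'I_m)
    (n r : nat) : set T :=
  \bigcap_(k in [set k | (n < k <= n + r)%N]) ~` (X k @^-1` [set j]).

Lemma measurable_avoids (d : measure_display) (T : measurableType d) (m : nat)
    (X : nat -> T -> 'I_m) (j : 'I_m) (n r : nat) :
  (forall n i, measurable (X n @^-1` [set i])) -> measurable (avoids X j n r).
Proof.
by move=> mX; apply: bigcap_measurableType => k _; apply: measurableC; exact: mX.
Qed.

Lemma trajectoryE (T : Type) (m : nat) (X : nat -> T -> 'I_m) s n :
  trajectory X s n = \bigcap_(k in [set k | (k <= n)%N]) (X k @^-1` [set s k]).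
Proof. by apply/seteqP; split => w /= h k /h. Qed.

Lemma measurable_trajectory (d : measure_display) (T : measurableType d)
    (m : nat) (X : nat -> T -> 'I_m) s n :
  (forall n i, measurable (X n @^-1` [set i])) -> measurable (trajectory X s n).
Proof.
by move=> mX; rewrite trajectoryE; apply: bigcap_measurableType => k _; exact: mX.
Qed.

(** Case split on the value [l] of [X n.+1]. The path [s] is overwritten by [l] after time [n], and
    only its value at [n.+1] matters. *)
Lemma trajectory_avoids_step (T : Type) (m : nat) (X : nat -> T -> 'I_m)
    (j : 'I_m) (s : nat -> 'I_m) (n r : nat) :
  trajectory X s n `&` avoids X j n r.+1 =
  \big[setU/set0]_(l | l != j)
    (trajectory X (fun k => if (k <= n)%N then s k else l) n.+1
       `&` avoids X j n.+1 r).
Proof.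
rewrite -bigcup_seq_cond; apply/seteqP; split => w.
  move=> [sw aw]; exists (X n.+1 w).
    rewrite /= mem_index_enum /=; apply/eqP.
    have nr : (n < n.+1 <= n + r.+1)%N by rewrite ltnSn addnS ltnS leq_addr.
    exact: aw _ nr.
  split => k /= kn; last first.
    have nr : (n < k <= n + r.+1)%N by rewrite addnS -addSn; case/andP: kn => /ltnW -> ->.
    exact: aw _ nr.
  by case: leqP => kn'; [exact: sw|congr (X _ w); apply/eqP; rewrite eqn_leq kn kn'].
move=> [l /= /andP[_ lj] [sw aw]]; split => k /= kn.
  by have := sw k (leqW kn); rewrite kn.
have [kn1|kn1] := leqP k n.+1; last first.
  have nr : (n.+1 < k <= n.+1 + r)%N by rewrite kn1 addSn -addnS; case/andP: kn.
  exact: aw _ nr.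
have -> : k = n.+1 by apply/eqP; rewrite eqn_leq kn1; case/andP: kn.
by rewrite (sw n.+1 (leqnn _)) ltnn; exact/eqP.
Qed.

(** Induction on [r] for all [n] and [s]: the pieces of the one-step split are disjoint, and the
    product form of the Markov property turns their sum into a row of $Q$ applied to the previous
    survival vector. Null trajectories are included, as nothing is divided. *)
Lemma measure_trajectory_avoids (R : realType) (d : measure_display)
    (T : measurableType d) (Pr : probability T R) (m : nat)
    (X : nat -> T -> 'I_m) (P : 'M[R]_m) (j : 'I_m) (r n : nat)
    (s : nat -> 'I_m) :
  row_stochastic P -> markov_chain Pr X P ->
  Pr (trajectory X s n `&` avoids X j n r)
    = (Pr (trajectory X s n) * (survival P j r (s n) 0)%:E)%E.
Proof.
move=> hP [mX markov]; elim: r n s => [|r IH] n s.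
  rewrite /= ones_eq1 mule1; congr (Pr _); apply/seteqP; split => [w []//|w sw].
  by split => // k /=; rewrite addn0 => /andP[/leq_trans h /h]; rewrite ltnn.
have mF l : measurable (trajectory X (fun k => if (k <= n)%N then s k else l) n.+1
       `&` avoids X j n.+1 r).
  by apply: measurableI; [exact: measurable_trajectory|exact: measurable_avoids].
rewrite trajectory_avoids_step.
transitivity (\sum_(l | l != j)
    Pr (trajectory X (fun k => if (k <= n)%N then s k else l) n.+1
          `&` avoids X j n.+1 r))%E.
  apply: measure_bigsetU_ord_cond => // k l _ _ [w [[kw _] [lw _]]].
  by have := kw n.+1 (leqnn _); rewrite (lw n.+1 (leqnn _)) ltnn.
under eq_bigr do rewrite IH markov ltnn leqnn.
rewrite /= mxE -sumEFin ge0_sume_distrr; last first.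
  move=> l _; rewrite lee_fin mulr_ge0 ?taboo_ge0//.
  by case/andP: (survival_ge0_le1 j r l hP).
(* The term [l = j] of the row of $Q$ is zero, matching its absence from the split. *)
rewrite [RHS](bigD1 j)//= [in X in (_ = X + _)%E]mxE eqxx mul0r mule0 add0e.
apply: eq_bigr => l lj; rewrite mxE (negbTE lj) EFinM muleA; congr (_ * _ * _)%E.
congr (Pr _); apply/seteqP; split => w h k kn; have := h k kn; by rewrite kn.
Qed.

(** * Expectation of the first passage time *)

(** Tail sum: a time $N \ge 1$ equals $\sum_{n \ge 0} 1_{N > n}$, and $N > n$ means that [j] is
    avoided at times $1, \dots, n$. If [j] is never met, the empty infimum and the series of ones
    are both infinite. *)
Lemma first_passage_time_series (R : realType) (T : Type) (m : nat)
    (X : nat -> T -> 'I_m) (j : 'I_m) (w : T) :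
  first_passage_time R X j w =
    (\sum_(0 <= n <oo) (\1_(avoids X j 0 n) w : R)%:E)%E.
Proof.
have [[n0 n0P]|never] := pselect (exists n, (0 < n)%N && (X n w == j)); last first.
  have a1 n : (\1_(avoids X j 0 n) w : R) = 1.
    rewrite indicE mem_set// => k /= /andP[k0 _] Xk; apply: never; exists k.
    by rewrite k0; apply/eqP.
  rewrite /first_passage_time (_ : [set _ | _ in _] = set0); last first.
    rewrite -subset0 => y [n [n_gt0 Xn] _]; apply: never; exists n.
    by rewrite n_gt0; apply/eqP.
  rewrite ereal_inf0; apply/esym/cvg_lim => //.
  rewrite (_ : (fun n => _) = fun n => (n%:R : R)%:E); first exact/cvgenyP.
  apply/funext => n; rewrite (eq_bigr (fun=> 1%:E)) => [|k _]; last by rewrite a1.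
  by rewrite big_mkord sumEFin sumr_const card_ord.
have ex : exists n, (0 < n)%N && (X n w == j) by exists n0.
have := ex_minnP ex; case=> N /andP[N0 /eqP XN] Nmin.
(* With [N] the first positive visit, exactly the terms $0, \dots, N - 1$ are 1; the term $n = 0$
   counts because its window is empty. *)
have a1 n : (\1_(avoids X j 0 n) w : R) = (n < N)%N%:R.
  rewrite indicE; congr (_%:R); congr (nat_of_bool _).
  apply/idP/idP; last first.
    move=> nN; apply/mem_set => k /= /andP[k0 kn] Xk.
    have := Nmin k; rewrite k0 Xk eqxx => /(_ isT); rewrite leqNgt.
    by rewrite (leq_ltn_trans kn nN).
  move=> /set_mem h; rewrite ltnNge; apply/negP => Nn.
  by apply: (h N) => //=; rewrite N0.
transitivity ((N%:R)%:E : \bar R).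
  apply/eqP; rewrite eq_le; apply/andP; split.
    by apply: ereal_inf_lbound; exists N.
  apply: le_ereal_inf_tmp => _ [n [n0' Xn] <-]; rewrite lee_fin ler_nat.
  by apply: Nmin; rewrite n0' Xn eqxx.
rewrite (nneseries_split 0 N); last by move=> k _; rewrite lee_fin a1.
rewrite eseries0 ?adde0; last by move=> i /= Ni _; rewrite a1 ltnNge Ni.
rewrite add0n big_mkord (eq_bigr (fun=> 1%:E)); last by move=> i _; rewrite a1 ltn_ord.
by rewrite sumEFin sumr_const card_ord.
Qed.

(** Integrating the tail sum termwise over $X_0 = i$ gives the probability of that event times the
    sum of survival probabilities; conditioning divides the factor out. *)
Lemma mean_first_passage_timeE (R : realType) (d : measure_display)
    (T : measurableType d) (m : nat) (Pr : 'I_m -> probability T R)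
    (X : nat -> T -> 'I_m) (P : 'M[R]_m) (i j : 'I_m) :
  row_stochastic P -> irreducible P -> markov_chain (Pr i) X P ->
  (0 < Pr i (X 0%N @^-1` [set i]))%E ->
  mean_first_passage_time Pr X i j = (mean_passage P j i 0)%:E.
Proof.
move=> hP hirr hX hX0; case: (hX) => mX _.
rewrite /mean_first_passage_time /cond_expectation.
set A := X 0%N @^-1` [set i].
have PA : Pr i A = (fine (Pr i A))%:E by rewrite fineK// fin_num_measure//; exact: mX.
have a0 : 0 < fine (Pr i A) by rewrite -lte_fin -PA.
(* The conditioning event is a trajectory of length zero, so the avoidance formula applies with
   [n = 0]. *)
have AE : A = trajectory X (fun=> i) 0.
  by apply/seteqP; split => [w Aw k|w /(_ 0%N)/=]; [rewrite leqn0 => /eqP ->|apply].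
rewrite (eq_integral (fun w => \sum_(0 <= n <oo) (\1_(avoids X j 0 n) w : R)%:E)%E); last first.
  by move=> w _; exact: first_passage_time_series.
(* Nonnegative terms allow the interchange before finiteness is known; finiteness then comes from
   the limit. *)
rewrite integral_nneseries; last 3 first.
- exact: mX.
- move=> n; apply/measurable_EFinP; apply: measurable_indic; exact: measurable_avoids.
- by move=> n w _; rewrite lee_fin.
have E n : (\int[Pr i]_(w in A) (\1_(avoids X j 0 n) w)%:E
    = (fine (Pr i A))%:E * (survival P j n i 0)%:E)%E.
  rewrite integral_indic; [|exact: mX|exact: measurable_avoids].
  by rewrite -PA setIC AE; exact: (@measure_trajectory_avoids _ _ _ (Pr i) m X P j n 0 (fun=> i)).
under eq_eseriesr do rewrite E.
rewrite nneseriesZl; last first.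
  by move=> n _; rewrite lee_fin; case/andP: (survival_ge0_le1 j n i hP).
have -> : (\sum_(0 <= n <oo) (survival P j n i 0)%:E = (mean_passage P j i 0)%:E)%E.
  rewrite -(cvg_lim _ (cvg_sum_survival (j := j) (i := i) hP hirr))//.
  rewrite -EFin_lim; last by apply/cvg_ex; eexists; exact: cvg_sum_survival.
  by congr (limn _); apply/funext => n; rewrite /= /series/= sumEFin.
by rewrite -!EFinM mulrAC divff ?mul1r// gt_eqF.
Qed.

(** * Transfer of the real identities to the extended-real expectations *)

Theorem theorem10 (R : realType) (m : nat) (P : 'M[R]_m) (p : 'cV[R]_m)
    (d : measure_display) (T : measurableType d)
    (Pr : 'I_m -> probability T R) (X : nat -> T -> 'I_m)
    (hP : row_stochastic P) (hirr : irreducible P) (hp : stationary P p)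
    (hX : forall i, markov_chain (Pr i) X P)
    (hX0 : forall i, (0 < Pr i (X 0%N @^-1` [set i]))%E) :
  let M := mean_first_passage_time Pr X in
  let c := fun i => colsum P i 0 in
  let pi := fun i => p i 0 in
  let h := fun i => Hmx P i i in
  forall j : 'I_m,
    [/\ ((\sum_i M i j - \sum_i (c i)%:E * M i j)%E
           = (m%:R - c j / pi j)%:E
         /\ (m%:R - c j / pi j)%:E = (m%:R%:E - (c j)%:E * M j j)%E),
        ((\sum_i (c i)%:E * M i j)%E
           = (c j / pi j - 1 + m%:R * h j / pi j)%:E
         /\ (c j / pi j - 1 + m%:R * h j / pi j)%:E
           = ((c j)%:E * M j j - 1 + (m%:R * h j)%:E * M j j)%E)
      & ((\sum_i M i j)%E = (m%:R - 1 + m%:R * h j / pi j)%:E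
         /\ (m%:R - 1 + m%:R * h j / pi j)%:E
           = (m%:R%:E - 1 + (m%:R * h j)%:E * M j j)%E)].
Proof.
move=> M c pi h j.
have ME i : M i j = (mean_passage P j i 0)%:E by exact: mean_first_passage_timeE.
have xp := mean_return j hP hirr hp.
have p_neq0 : pi j != 0.
  by apply/eqP => p0; move: xp; rewrite -/(pi j) p0 mulr0 => /eqP; rewrite eq_sym oner_eq0.
have piV : (pi j)^-1 = mean_passage P j j 0.
  by apply: (mulIf p_neq0); rewrite mulVf.
have sumM : (\sum_i M i j = (\sum_i mean_passage P j i 0)%:E)%E.
  by rewrite -sumEFin; apply: eq_bigr => i _; rewrite ME.
have sumcM : (\sum_i (c i)%:E * M i j
    = (\sum_i colsum P i 0 * mean_passage P j i 0)%:E)%E.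
  by rewrite -sumEFin; apply: eq_bigr => i _; rewrite ME.
have e1 := colsum_mean_passage j hP hirr.
have e2 := colsum_mean_passage_Hmx j hP hirr hp.
(* The third identity is the sum of the first two. *)
have e3 : \sum_i mean_passage P j i 0
    = m%:R - 1 + m%:R * h j * mean_passage P j j 0 by rewrite /h; lra.
rewrite sumM sumcM ME piV -!EFinM -!EFinB e3 e2.
by split; split; congr (_%:E); rewrite /c /h; ring.
Qed.
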